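(* Let $\mu$ be a sigma-finite Borel measure on $\mathbb{R}$ without atoms, let $U\subset\mathbb{R}$ be an open subset with $\mu(\mathbb{R}\setminus U)=0$, and let $H$ be a reproducing kernel subspace in $L^2(\mathbb{R},\mu)$ (of functions on $U$) that separates zeros and such that for any $k\in U$ one has the implication $$f\in H,\ f(k)=0\ \Longrightarrow\ \frac{f}{x-k}\in H.$$ Then the reproducing kernel $K$ of $H$ is locally of trace class: for any compact $\Omega\subset U$ the operator $\chi_\Omega K\chi_\Omega$ on $L^2(\mathbb{R},\mu)$ is of trace class.
   Context: Functions are complex-valued. A linear set $H$ of Borel functions $f$ on $U$ (actual functions, not equivalence classes) satisfying $\int|f|^2\,d\mu<\infty$ is called a reproducing kernel subspace in $L^2(\mathbb{R},\mu)$ if it is closed in the $L^2(\mathbb{R},\mu)$ norm and, for every $k\in U$, the functional $f\mapsto f(k)$ on $H$ is bounded in the $L^2(\mathbb{R},\mu)$ norm. For $w\in U$, the reproducing kernel at $w$ is the element $K_w=K(\cdot,w)\in H$ with $f(w)=\langle f,K_w\rangle$ for all $f\in H$, where $\langle f,g\rangle=\int f\overline{g}\,d\mu$; thus $K(x,y)=K_y(x)$. $H$ separates zeros if for any $p\in U$ there exists $f_p\in H$ with $f_p(p)\neq0$. An expression of the form $g/(x-p)\in H$ means that there is a (unique) function $h\in H$ such that $h(x)(x-p)=g(x)$ for all $x\in U$. In $\chi_\Omega K\chi_\Omega$, $\chi_\Omega$ is the operator of multiplication by the indicator function of $\Omega$, and $K$ is the integral operator in $L^2(\mathbb{R},\mu)$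 with kernel $K(x,y)$, i.e. the orthogonal projection of $L^2(\mathbb{R},\mu)$ onto $H$. *)

(* Defs.v *)
From HB Require Import structures.
From mathcomp Require Import all_boot all_order all_algebra.
From mathcomp Require Import all_classical all_reals all_analysis.
From mathcomp Require Import complex.

Set Implicit Arguments.
Unset Strict Implicit.
Unset Printing Implicit Defensive.
Import Order.TTheory GRing.Theory Num.Theory.
Import numFieldTopology.Exports numFieldNormedType.Exports.

Local Open Scope classical_set_scope.
Local Open Scope ring_scope.
Local Open Scope complex_scope.

Section L2.
Variables (R : realType) (mu : {measure set (measurableTypeR R) -> \bar R}).
Implicit Types (f g : R -> R[i]) (T A B : (R -> R[i]) -> (R -> R[i])).

Definition borel_fun f : Prop :=
  measurable_fun [set: measurableTypeR R] (fun x => complex.Re (f x)) /\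
  measurable_fun [set: measurableTypeR R] (fun x => complex.Im (f x)).

Definition cintegral (D : set R) f : R[i] :=
  (\int[mu]_(x in D) complex.Re (f x)) +i*
  (\int[mu]_(x in D) complex.Im (f x)).

(* Everything below works with representatives: [L2] is a set of actual
   functions, and the elements of L^2(R, mu) are the classes of [aeq] in it. *)
Definition aeq f g : Prop := {ae mu, forall x, f x = g x}.

Definition L2 : set (R -> R[i]) :=
  [set f | borel_fun f /\
    (\int[mu]_x ((complex.Re `|f x|) ^+ 2)%:E < +oo)%E].

Definition L2norm f : R :=
  Num.sqrt (\int[mu]_x (complex.Re `|f x|) ^+ 2).

Definition L2dot f g : R[i] := cintegral setT (fun x => f x * (g x)^*).

(* Boundedness and linearity modulo [aeq] imply that [T] maps [aeq] elements
   of [L2] to [aeq] ones, so these are the bounded operators on the quotient. *)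
Definition bounded_operator T : Prop :=
  [/\ forall f, L2 f -> L2 (T f),
      forall (a : R[i]) f g, L2 f -> L2 g ->
        aeq (T (fun x => a * f x + g x)) (fun x => a * T f x + T g x) &
      exists M : R, forall f, L2 f -> L2norm (T f) <= M * L2norm f].

Definition adjoint T B : Prop :=
  forall f g, L2 f -> L2 g -> L2dot (T f) g = L2dot f (B g).

(* The order of R[i] makes [0 <= z] include that [z] is real. *)
Definition positive_operator A : Prop :=
  forall f, L2 f -> 0 <= L2dot (A f) f.

(* A = |T|, the positive square root of T^* T. *)
Definition absolute_value T A : Prop :=
  [/\ bounded_operator A, positive_operator A &
      exists B, [/\ bounded_operator B, adjoint T B &
        forall f, L2 f -> aeq (A (A f)) (B (T f))]].

Definition orthonormal_basis (S : set (R -> R[i])) : Prop :=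
  [/\ S `<=` L2,
      forall e, S e -> L2dot e e = 1,
      forall e e', S e -> S e' -> e <> e' -> L2dot e e' = 0 &
      forall f, L2 f -> (forall e, S e -> L2dot f e = 0) ->
        aeq f (fun=> 0)].

(* tr |T| < oo; the value of tr |T| does not depend on the basis. *)
Definition trace_class T : Prop :=
  bounded_operator T /\
  exists A, absolute_value T A /\
    exists S, orthonormal_basis S /\
      (\esum_(e in S) (complex.Re (L2dot (A e) e))%:E < +oo)%E.

(* Functions on U are represented by their extension by 0 to the whole line;
   for open U this keeps Borel measurability. *)
Definition function_on (U : set R) f : Prop := forall x, ~ U x -> f x = 0.

Definition linear_set (H : set (R -> R[i])) : Prop :=
  H (fun=> 0) /\
  forall (a : R[i]) f g, H f -> H g -> H (fun x => a * f x + g x).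

(* H consists of functions, not of classes: what is closed is the set of the
   classes of the elements of H. *)
Definition L2_closed (H : set (R -> R[i])) : Prop :=
  forall (f_ : nat -> R -> R[i]) f, (forall n, H (f_ n)) -> L2 f ->
    (fun n => L2norm (fun x => f_ n x - f x)) @ \oo --> (0 : R) ->
    exists2 h, H h & aeq h f.

Definition RK_subspace (U : set R) (H : set (R -> R[i])) : Prop :=
  [/\ forall f, H f -> function_on U f /\ L2 f,
      linear_set H,
      L2_closed H &
      forall k, U k -> exists M : R,
        forall f, H f -> `|f k| <= (M * L2norm f)%:C].

(* K x y = K_y x. *)
Definition reproducing_kernel (U : set R) (H : set (R -> R[i]))
    (K : R -> R -> R[i]) : Prop :=
  forall w, U w ->
    H (fun x => K x w) /\ forall f, H f -> f w = L2dot f (fun x => K x w).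

(* The integral runs over U, where K(x, .) is meaningful; the complement of U
   is mu-null. *)
Definition integral_operator (U : set R) (K : R -> R -> R[i]) f : R -> R[i] :=
  fun x => cintegral U (fun y => K x y * f y).

Definition mul_indic (Om : set R) f : R -> R[i] :=
  fun x => (\1_Om x)%:C * f x.

End L2.

Section division.
Variable R : realType.
Implicit Types (U : set R) (H : set (R -> R[i])).

Definition separates_zeros U H : Prop :=
  forall p, U p -> exists2 f, H f & f p <> 0.

Definition quotient_in U H (g : R -> R[i]) (p : R) : Prop :=
  exists2 h, H h & forall x, U x -> h x * (x - p)%:C = g x.

Definition division_property U H : Prop :=
  forall k, U k -> forall f, H f -> f k = 0 -> quotient_in U H f k.

End division.

Definition without_atoms (R : realType)
    (mu : {measure set (measurableTypeR R) -> \bar R}) : Prop :=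
  forall x : R, mu [set x] = 0%E.

(* Main.v *)
Require Import Defs.
From mathcomp Require Import all_boot all_order all_algebra.
From mathcomp Require Import all_classical all_reals all_analysis.
From mathcomp Require Import measurable_realfun complex ring lra zify.

(** For p in U pick g in H with g(p) <> 0. The operator
    T f = (f - f(p)/g(p) g) / (x - p) on H is bounded by the closed graph
    theorem, and iterating f(k) = f(p)/g(p) g(k) + (k - p) (T f)(k) gives
    |f(k)| <= C |g(k)| ||f|| for k near p. By compactness there is an integrable
    G with |f(x)|^2 <= G(x) ||f||^2 for x in Omega and f in H. The operator
    chi K chi is positive, so it is its own absolute value, and its trace is at
    most the integral of G. *)

Set Implicit Arguments.
Unset Strict Implicit.
Unset Printing Implicit Defensive.
Import Order.TTheory GRing.Theory Num.Theory.
Import numFieldTopology.Exports numFieldNormedType.Exports.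

Local Open Scope classical_set_scope.
Local Open Scope complex_scope.
Local Open Scope ring_scope.

(** Each evaluation is bounded on [H], but by a constant $M_k$ of which nothing is known as a
    function of k. The comparison with $|g(k)|^2$ cures this: $|g|^2$ is integrable because g lies
    in $L^2$, and every iteration halves the share of $M_k$ once $|k-p|$ is small against the norm
    of T, so that $M_k$ drops out in the limit. The graph of T is closed because, for x other than
    p, $(Tf)(x)$ is a fixed linear combination of f(x) and f(p), both continuous in f; the point p
    itself is negligible since the measure has no atoms. Positivity comes from K acting as the
    orthogonal projection P onto [H]: $\langle\chi P\chi f,f\rangle=\|P\chi f\|^2$. The trace is
    reached through finite orthonormal families, by integrating a pointwise inequality in which G(x)
    majorizes K(x,x) on $\Omega$. *)

(** * Coordinates and squared modulus of complex numbers *)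

Section Complex.
Variable R : realType.
Implicit Types a b z w : R[i].

Definition sqn z : R := complex.Re z ^+ 2 + complex.Im z ^+ 2.

Lemma ReM a b : complex.Re (a * b) =
  complex.Re a * complex.Re b - complex.Im a * complex.Im b.
Proof. by case: a b => [? ?] [? ?]. Qed.

Lemma ImM a b : complex.Im (a * b) =
  complex.Re a * complex.Im b + complex.Im a * complex.Re b.
Proof. by case: a b => [? ?] [? ?]. Qed.

Lemma ReJ z : complex.Re z^* = complex.Re z. Proof. by case: z. Qed.

Lemma ImJ z : complex.Im z^* = - complex.Im z. Proof. by case: z. Qed.

Lemma Re_rc (r : R) : complex.Re r%:C = r. Proof. by []. Qed.

Lemma Im_rc (r : R) : complex.Im r%:C = 0. Proof. by []. Qed.

Lemma eq_complexP z w :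
  complex.Re z = complex.Re w -> complex.Im z = complex.Im w -> z = w.
Proof. by case: z w => [? ?] [? ?] /= -> ->. Qed.

Lemma ReD z w : complex.Re (z + w) = complex.Re z + complex.Re w.
Proof. by case: z w => [? ?] [? ?]. Qed.

Lemma ImD z w : complex.Im (z + w) = complex.Im z + complex.Im w.
Proof. by case: z w => [? ?] [? ?]. Qed.

Lemma ReN z : complex.Re (- z) = - complex.Re z. Proof. by case: z. Qed.

Lemma ImN z : complex.Im (- z) = - complex.Im z. Proof. by case: z. Qed.

Definition cE := (ReM, ImM, ReJ, ImJ, Re_rc, Im_rc, ReD, ImD, ReN, ImN).

Lemma conjcD z w : (z + w)^* = z^* + w^*.
Proof. by apply: eq_complexP; rewrite !cE// opprD. Qed.

Lemma conjcM z w : (z * w)^* = z^* * w^*.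
Proof. by apply: eq_complexP; rewrite !cE; ring. Qed.

Lemma sqn_ge0 z : 0 <= sqn z. Proof. by rewrite addr_ge0 ?sqr_ge0. Qed.

Lemma sqn_norm z : complex.Re `|z| ^+ 2 = sqn z.
Proof. by rewrite normc_def sqr_sqrtr// sqn_ge0. Qed.

Lemma sqnM z w : sqn (z * w) = sqn z * sqn w.
Proof. rewrite /sqn !cE; ring. Qed.

Lemma sqnD_le z w : sqn (z + w) <= 2 * sqn z + 2 * sqn w.
Proof.
rewrite /sqn !cE.
have := sqr_ge0 (complex.Re z - complex.Re w).
have := sqr_ge0 (complex.Im z - complex.Im w); lra.
Qed.

Lemma sqn_eq0 z : sqn z = 0 -> z = 0.
Proof.
move=> /eqP; rewrite paddr_eq0 ?sqr_ge0// !sqrf_eq0 => /andP[/eqP ? /eqP ?].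
exact: eq_complexP.
Qed.

Lemma sqn_rc (r : R) : sqn r%:C = r ^+ 2.
Proof. rewrite /sqn !cE; ring. Qed.

Lemma sqnV z : sqn z^-1 = (sqn z)^-1.
Proof.
have [->|z0] := eqVneq z 0; first by rewrite invr0 /sqn/= expr0n/= addr0 invr0.
have sz : sqn z != 0 by apply: contra z0 => /eqP/sqn_eq0 ->.
apply: (mulfI sz); rewrite -sqnM !divff//.
by rewrite /sqn/= expr1n expr0n/= addr0.
Qed.

Lemma norm_rcE z : `|z| = (Num.sqrt (sqn z))%:C.
Proof. by rewrite normc_def. Qed.

End Complex.

(** * Square-integrable functions: inner product and squared norm *)

Section L2_theory.
Variables (R : realType) (mu : {measure set (measurableTypeR R) -> \bar R}).
Implicit Types f g h : R -> R[i].

Local Notation L2 := (L2 mu).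
Local Notation L2dot := (L2dot mu).
Local Notation L2norm := (L2norm mu).

Definition rint (f : measurableTypeR R -> R) :=
  mu.-integrable [set: measurableTypeR R] (EFin \o f).

(** The squared $L^2$ norm. A real-valued integral takes the default value 0 when the extended one
    is infinite, so bounds on [energy] carry information only together with membership in [L2]. *)
Definition energy f : R := \int[mu]_x sqn (f x).

Definition cint f := rint (fun x => complex.Re (f x)) /\
                     rint (fun x => complex.Im (f x)).

Lemma rintD (f g : R -> R) : rint f -> rint g -> rint (fun x => f x + g x).
Proof. by move=> rf rg; exact: integrableD rf rg. Qed.

Lemma rintZ (r : R) (f : R -> R) : rint f -> rint (fun x => r * f x).
Proof. by move=> rf; exact: integrableZl rf. Qed.

Lemma rintN (f : R -> R) : rint f -> rint (fun x => - f x).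
Proof. by move=> rf; exact: integrableN rf. Qed.

Lemma rint_sum (I : eqType) (s : seq I) (f_ : I -> R -> R) :
  (forall i, i \in s -> rint (f_ i)) -> rint (fun x => \sum_(i <- s) f_ i x).
Proof.
elim: s => [|i s IH] fs.
  by under eq_fun do rewrite big_nil; exact: integrable0.
under eq_fun do rewrite big_cons.
apply: rintD; first by apply: fs; rewrite inE eqxx.
by apply: IH => j js; apply: fs; rewrite inE js orbT.
Qed.

Lemma rint_le (f g : measurableTypeR R -> R) : measurable_fun setT f ->
  (forall x, `|f x| <= g x) -> rint g -> rint f.
Proof.
move=> mf fg rg; apply: le_integrable rg => //; first exact/measurable_EFinP.
by move=> x _ /=; rewrite lee_fin; exact: le_trans (fg x) (ler_norm _).
Qed.

Lemma rint_meas (f : measurableTypeR R -> R) : rint f -> measurable_fun setT f.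
Proof. by move=> /measurable_int/measurable_EFinP. Qed.

Lemma borel_lin (a : R[i]) f g : borel_fun f -> borel_fun g ->
  borel_fun (fun x => a * f x + g x).
Proof.
move=> [f1 f2] [g1 g2]; split.
  under eq_fun do rewrite !cE.
  apply: measurable_funD => //; apply: measurable_funB; exact: measurable_funM.
under eq_fun do rewrite !cE.
by apply: measurable_funD => //; apply: measurable_funD; exact: measurable_funM.
Qed.

Lemma borelM f g : borel_fun f -> borel_fun g -> borel_fun (fun x => f x * g x).
Proof.
move=> [f1 f2] [g1 g2]; split; under eq_fun do rewrite !cE.
  by apply: measurable_funB; exact: measurable_funM.
by apply: measurable_funD; exact: measurable_funM.
Qed.

Lemma borelJ f : borel_fun f -> borel_fun (fun x => (f x)^*).
Proof.
move=> [f1 f2]; split; under eq_fun do rewrite !cE; first exact: f1.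
exact: measurableT_comp.
Qed.

Lemma borel_cst (a : R[i]) : borel_fun (fun=> a).
Proof. by split; exact: measurable_cst. Qed.

Lemma borel_sqn f : borel_fun f ->
  measurable_fun [set: measurableTypeR R] (fun x => sqn (f x)).
Proof.
move=> [f1 f2]; rewrite /sqn; apply: measurable_funD.
  exact: (measurable_funX 2 f1).
exact: (measurable_funX 2 f2).
Qed.

Lemma L2P f : L2 f <-> borel_fun f /\ rint (fun x => sqn (f x)).
Proof.
rewrite /Defs.L2/=; split=> -[bf i]; split => //.
  apply/integrableP; split; first by apply/measurable_EFinP; exact: borel_sqn.
  apply: le_lt_trans i; rewrite le_eqVlt; apply/orP; left; apply/eqP.
  by apply: eq_integral => x _ /=; rewrite sqn_norm ger0_norm// sqn_ge0.
case/integrableP : i => _; apply: le_lt_trans.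
rewrite le_eqVlt; apply/orP; left; apply/eqP.
by apply: eq_integral => x _ /=; rewrite sqn_norm ger0_norm// sqn_ge0.
Qed.

Lemma L2_borel f : L2 f -> borel_fun f. Proof. by case. Qed.

Lemma L2_int f : L2 f -> rint (fun x => sqn (f x)).
Proof. by case/L2P. Qed.

Lemma energy_ge0 f : 0 <= energy f.
Proof. by apply: Rintegral_ge0 => x _; exact: sqn_ge0. Qed.

Lemma energyE f : L2 f -> (energy f)%:E = (\int[mu]_x (sqn (f x))%:E)%E.
Proof.
by move=> Lf; rewrite fineK//; exact: (integrable_fin_num measurableT (L2_int Lf)).
Qed.

Lemma L2normE f : L2norm f = Num.sqrt (energy f).
Proof.
by congr Num.sqrt; apply: eq_Rintegral => x _; rewrite sqn_norm.
Qed.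

Lemma L2norm_sqr f : L2norm f ^+ 2 = energy f.
Proof. by rewrite L2normE sqr_sqrtr// energy_ge0. Qed.

Lemma L2_le f (G : R -> R) : borel_fun f ->
  (forall x, sqn (f x) <= G x) -> rint G -> L2 f.
Proof.
move=> bf fG rG; apply/L2P; split => //; apply: rint_le rG.
  exact: borel_sqn.
by move=> x; rewrite ger0_norm// sqn_ge0.
Qed.

Lemma L2_lin (a : R[i]) f g : L2 f -> L2 g -> L2 (fun x => a * f x + g x).
Proof.
move=> /L2P[bf rf] /L2P[bg rg].
apply: (@L2_le _ (fun x => 2 * sqn a * sqn (f x) + 2 * sqn (g x))).
- exact: borel_lin.
- by move=> x; rewrite (le_trans (sqnD_le _ _))// sqnM mulrA.
- by apply: rintD; exact: rintZ.
Qed.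

Lemma L2_0 : L2 (fun=> 0).
Proof.
apply/L2P; split; first exact: borel_cst.
have -> : (fun=> sqn 0) = (fun=> 0) :> (R -> R).
  by apply/funext => x; rewrite /sqn/=; ring.
exact: integrable0.
Qed.

Lemma L2D f g : L2 f -> L2 g -> L2 (fun x => f x + g x).
Proof.
move=> Lf Lg; have := L2_lin 1 Lf Lg.
by under eq_fun do rewrite mul1r.
Qed.

Lemma L2Z (a : R[i]) f : L2 f -> L2 (fun x => a * f x).
Proof.
move=> Lf; have := L2_lin a Lf L2_0.
by under eq_fun do rewrite addr0.
Qed.

Lemma L2B f g : L2 f -> L2 g -> L2 (fun x => f x - g x).
Proof.
move=> Lf Lg; have := L2D Lf (L2Z (-1) Lg).
by under eq_fun do rewrite mulN1r.
Qed.

(** Up to sign and order, both coordinates of $z\bar w$ have the form $ac+bd$; this crude bound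
    makes $f\bar g$ integrable. *)
Lemma ler_norm_dot2 (a b c d : R) :
  `|a * c + b * d| <= a ^+ 2 + b ^+ 2 + (c ^+ 2 + d ^+ 2).
Proof.
have := (sqr_ge0 (a + c), sqr_ge0 (a - c)).
have := (sqr_ge0 (b + d), sqr_ge0 (b - d)).
have := (sqr_ge0 a, sqr_ge0 b, sqr_ge0 c, sqr_ge0 d).
move=> [[[? ?] ?] ?] [? ?] [? ?]; rewrite ler_norml; lra.
Qed.

Lemma cint_dot f g : L2 f -> L2 g -> cint (fun x => f x * (g x)^*).
Proof.
move=> Lf Lg; have [m1 m2] := borelM (L2_borel Lf) (borelJ (L2_borel Lg)).
split; apply: (rint_le _ _ (rintD (L2_int Lf) (L2_int Lg))) => // x.
  by rewrite !cE mulrN opprK; exact: ler_norm_dot2.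
rewrite !cE mulrN addrC [X in _ <= _ + X]addrC -mulrN.
rewrite -[X in _ <= _ + (X + _)]sqrrN addrC; exact: ler_norm_dot2.
Qed.

Lemma RintD (f g : R -> R) : rint f -> rint g ->
  \int[mu]_x (f x + g x) = \int[mu]_x f x + \int[mu]_x g x.
Proof. by move=> *; exact: RintegralD. Qed.

Lemma RintZ (r : R) (f : R -> R) : rint f -> \int[mu]_x (r * f x) = r * \int[mu]_x f x.
Proof. by move=> *; exact: RintegralZl. Qed.

Lemma cint_lin (a : R[i]) f g : cint f -> cint g ->
  cint (fun x => a * f x + g x).
Proof.
move=> [f1 f2] [g1 g2]; split; under eq_fun do rewrite !cE.
  by apply: rintD => //; apply: rintD; [exact: rintZ|exact/rintN/rintZ].
by apply: rintD => //; apply: rintD; exact: rintZ.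
Qed.

Lemma Re_cintegral D f :
  complex.Re (cintegral mu D f) = \int[mu]_(x in D) complex.Re (f x).
Proof. by []. Qed.

Lemma Im_cintegral D f :
  complex.Im (cintegral mu D f) = \int[mu]_(x in D) complex.Im (f x).
Proof. by []. Qed.

Lemma cintegral_lin (a : R[i]) f g : cint f -> cint g ->
  cintegral mu setT (fun x => a * f x + g x) =
  a * cintegral mu setT f + cintegral mu setT g.
Proof.
move=> [f1 f2] [g1 g2]; apply: eq_complexP; rewrite !cE !(Re_cintegral, Im_cintegral).
  under [LHS]eq_Rintegral do rewrite !cE -mulNr.
  rewrite RintD//; last by apply: rintD; exact: rintZ.
  by rewrite RintD ?RintZ// ?mulNr//; exact: rintZ.
under [LHS]eq_Rintegral do rewrite !cE.
rewrite RintD//; last by apply: rintD; exact: rintZ.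
by rewrite RintD ?RintZ//; exact: rintZ.
Qed.

Lemma L2dot_linl (a : R[i]) f g h : L2 f -> L2 g -> L2 h ->
  L2dot (fun x => a * f x + g x) h = a * L2dot f h + L2dot g h.
Proof.
move=> Lf Lg Lh; rewrite /Defs.L2dot -cintegral_lin; try exact: cint_dot.
by congr cintegral; apply/funext => x; ring.
Qed.

Lemma L2dotC f g : L2 f -> L2 g -> L2dot f g = (L2dot g f)^*.
Proof.
move=> Lf Lg; have [_ r2] := cint_dot Lg Lf.
apply: eq_complexP; rewrite /Defs.L2dot ?cE ?(Re_cintegral, Im_cintegral).
  by apply: eq_Rintegral => x _; rewrite !cE; ring.
rewrite -mulN1r -RintZ//; apply: eq_Rintegral => x _; rewrite !cE; ring.
Qed.

Lemma L2dot_linr (a : R[i]) f g h : L2 f -> L2 g -> L2 h ->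
  L2dot h (fun x => a * f x + g x) = a^* * L2dot h f + L2dot h g.
Proof.
move=> Lf Lg Lh; rewrite L2dotC//; last exact: L2_lin.
by rewrite L2dot_linl// conjcD conjcM -!L2dotC.
Qed.

Lemma L2dot_energy f : L2dot f f = (energy f)%:C.
Proof.
apply: eq_complexP; rewrite /Defs.L2dot ?cE ?(Re_cintegral, Im_cintegral).
  by apply: eq_Rintegral => x _; rewrite !cE /sqn; ring.
under [LHS]eq_Rintegral do rewrite !cE mulrN mulrC addNr.
by rewrite Rintegral_cst// mul0r.
Qed.

Lemma L2dot0l g : L2dot (fun=> 0) g = 0.
Proof.
rewrite /Defs.L2dot /cintegral; under eq_Rintegral do rewrite mul0r.
rewrite Rintegral_cst// mul0r.
under eq_Rintegral do rewrite mul0r.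
by rewrite Rintegral_cst// mul0r.
Qed.

Lemma L2dotDl f g h : L2 f -> L2 g -> L2 h ->
  L2dot (fun x => f x + g x) h = L2dot f h + L2dot g h.
Proof.
move=> Lf Lg Lh; rewrite -[L2dot f h]mul1r -L2dot_linl//.
by under [in RHS]eq_fun do rewrite mul1r.
Qed.

Lemma L2dotZl (a : R[i]) f h : L2 f -> L2 h ->
  L2dot (fun x => a * f x) h = a * L2dot f h.
Proof.
move=> Lf Lh; rewrite -[RHS]addr0 -(L2dot0l h) -L2dot_linl//; last exact: L2_0.
by under [in RHS]eq_fun do rewrite addr0.
Qed.

Lemma L2dotBl f g h : L2 f -> L2 g -> L2 h ->
  L2dot (fun x => f x - g x) h = L2dot f h - L2dot g h.
Proof.
move=> Lf Lg Lh; have := L2dotDl Lf (L2Z (-1) Lg) Lh.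
by rewrite L2dotZl// mulN1r; under eq_fun do rewrite mulN1r.
Qed.

Lemma energy_lin (a : R[i]) f g : L2 f -> L2 g ->
  energy (fun x => a * f x + g x) =
  sqn a * energy f + 2 * complex.Re (a * L2dot f g) + energy g.
Proof.
move=> Lf Lg; apply: (@complexI R); rewrite -L2dot_energy L2dot_linl//; last first.
  exact: L2_lin.
rewrite !L2dot_linr// [L2dot g f]L2dotC// !L2dot_energy.
by apply: eq_complexP; rewrite /sqn !cE; ring.
Qed.

Lemma energyZ (a : R[i]) f : L2 f -> energy (fun x => a * f x) = sqn a * energy f.
Proof.
move=> Lf; rewrite /energy -RintZ//; last exact: L2_int.
by apply: eq_Rintegral => x _; rewrite sqnM.
Qed.

Lemma energyB f g : L2 f -> L2 g ->
  energy (fun x => f x - g x) =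
  energy f - 2 * complex.Re (L2dot f g) + energy g.
Proof.
move=> Lf Lg; have := energy_lin (-1) Lg Lf.
under eq_fun do rewrite addrC mulN1r.
move=> ->; rewrite mulN1r ReN L2dotC// ReJ /sqn /=; ring.
Qed.

Lemma energyD f g : L2 f -> L2 g ->
  energy (fun x => f x + g x) =
  energy f + 2 * complex.Re (L2dot f g) + energy g.
Proof.
move=> Lf Lg; have := energy_lin 1 Lf Lg.
under eq_fun do rewrite mul1r.
by move=> ->; rewrite mul1r /sqn /=; ring.
Qed.

Lemma energyC f g : energy (fun x => f x - g x) = energy (fun x => g x - f x).
Proof. by apply: eq_Rintegral => x _; rewrite /sqn !cE; ring. Qed.

(** A triangle inequality for squares: in the parallelogram identity for $u=f-g$ and $v=g-h$, drop
    $\|u-v\|^2$. *)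
Lemma energyB_le f g h : L2 f -> L2 g -> L2 h ->
  energy (fun x => f x - h x) <=
  2 * energy (fun x => f x - g x) + 2 * energy (fun x => g x - h x).
Proof.
move=> Lf Lg Lh.
have e : forall x, f x - h x = (f x - g x) + (g x - h x) by move=> x; ring.
under eq_fun do rewrite e.
have [L1 L2] := (L2B Lf Lg, L2B Lg Lh).
have := energyB L1 L2; have := energyD L1 L2.
have := energy_ge0 (fun x => (f x - g x) - (g x - h x)).
lra.
Qed.

Lemma ae_sub (P Q : R -> Prop) : (forall x, P x -> Q x) ->
  {ae mu, forall x, P x} -> {ae mu, forall x, Q x}.
Proof.
move=> PQ [N [mN N0 PN]]; exists N; split => // x /= nQ; apply: PN => /= Px.
exact/nQ/PQ.
Qed.

Lemma aeq_energy0 f : borel_fun f -> aeq mu f (fun=> 0) -> energy f = 0.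
Proof.
move=> bf f0; rewrite /energy /Rintegral.
rewrite (@ae_eq_integral _ _ _ mu setT (cst 0%E))//.
- by rewrite integral0.
- by apply/measurable_EFinP; exact: borel_sqn.
- apply: ae_sub f0 => x /= -> _.
  by congr EFin; rewrite /sqn /=; ring.
Qed.

Lemma energy0_aeq f : L2 f -> energy f = 0 -> aeq mu f (fun=> 0).
Proof.
move=> Lf e0.
have m := rint_meas (L2_int Lf).
have i0 : (\int[mu]_x `|(EFin \o (fun x => sqn (f x))) x| = 0)%E.
  rewrite -[RHS]/(0%:E) -e0 energyE//.
  by apply: eq_integral => x _ /=; rewrite ger0_norm// sqn_ge0.
have /(ae_eq_integral_abs mu measurableT) H :
    measurable_fun [set: measurableTypeR R] (EFin \o (fun x => sqn (f x))).
  exact/measurable_EFinP.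
by move/H : i0; apply: ae_sub => x /(_ I)[] /sqn_eq0.
Qed.

End L2_theory.

(** * Convergence of complex sequences, by coordinates *)

Section Convergence.
Variables (R : realType).
Implicit Types (v w : nat -> R[i]) (l m : R[i]).

Definition ccvg v l :=
  (fun n => complex.Re (v n)) @ \oo --> complex.Re l /\
  (fun n => complex.Im (v n)) @ \oo --> complex.Im l.

Lemma near_lt (r : nat -> R) (e : R) : r @ \oo --> 0 -> 0 < e ->
  \forall n \near \oo, r n < e.
Proof. by move=> /cvgr_lt; apply. Qed.

Lemma sqr_le_cvg (w r : nat -> R) (y : R) :
  (forall n, (w n - y) ^+ 2 <= r n) -> r @ \oo --> 0 -> w @ \oo --> y.
Proof.
move=> wr r0; apply/cvgrPdist_lt => e e0.
have := near_lt r0 (exprn_gt0 2 e0); apply: filterS => n rn.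
rewrite -ltr_sqr ?nnegrE// ?ltW// distrC real_normK ?num_real//.
exact: le_lt_trans (wr n) rn.
Qed.

Lemma sqn_le_ccvg v l (r : nat -> R) :
  (forall n, sqn (v n - l) <= r n) -> r @ \oo --> 0 -> ccvg v l.
Proof.
move=> vr r0; split; apply: sqr_le_cvg r0 => n; apply: le_trans (vr n).
  by rewrite /sqn !cE lerDl sqr_ge0.
by rewrite /sqn !cE lerDr sqr_ge0.
Qed.

Lemma sqr_cauchy_cvg (w r : nat -> R) :
  (forall n m : nat, (n <= m)%N -> (w m - w n) ^+ 2 <= r n) -> r @ \oo --> 0 ->
  exists y : R, w @ \oo --> y.
Proof.
move=> wr r0; suff : cvg (w @ \oo) by move=> wc; exists (lim (w @ \oo)).
apply/cauchy_cvgP/cauchy_exP => e e0.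
have [n _ /(_ n (leqnn n)) rn] := near_lt r0 (exprn_gt0 2 e0).
exists (w n); exists n => // m /= nm.
rewrite /ball/= -ltr_sqr ?nnegrE// ?ltW// distrC real_normK ?num_real//.
exact: le_lt_trans (wr n m nm) rn.
Qed.

Lemma sqn_cauchy_ccvg v (r : nat -> R) :
  (forall n m : nat, (n <= m)%N -> sqn (v m - v n) <= r n) -> r @ \oo --> 0 ->
  exists l, ccvg v l.
Proof.
move=> vr r0.
have [|x vx] := @sqr_cauchy_cvg (fun n => complex.Re (v n)) r _ r0.
  by move=> n m /vr; apply: le_trans; rewrite /sqn !cE lerDl sqr_ge0.
have [|y vy] := @sqr_cauchy_cvg (fun n => complex.Im (v n)) r _ r0.
  by move=> n m /vr; apply: le_trans; rewrite /sqn !cE lerDr sqr_ge0.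
by exists (x +i* y).
Qed.

Lemma ccvg_lin (a b : R[i]) v l : ccvg v l ->
  ccvg (fun n => a * v n + b) (a * l + b).
Proof.
move=> [v1 v2]; split; under eq_fun do rewrite !cE; rewrite !cE.
  by apply: cvgD; [apply: cvgB; exact: cvgMl_tmp|exact: cvg_cst].
by apply: cvgD; [apply: cvgD; exact: cvgMl_tmp|exact: cvg_cst].
Qed.

Lemma ccvg_comb (a b : R[i]) v w l m : ccvg v l -> ccvg w m ->
  ccvg (fun n => a * v n + b * w n) (a * l + b * m).
Proof.
move=> [v1 v2] [w1 w2]; split; under eq_fun do rewrite !cE; rewrite !cE.
  by apply: cvgD; apply: cvgB; exact: cvgMl_tmp.
by apply: cvgD; apply: cvgD; exact: cvgMl_tmp.
Qed.

Lemma ccvg_sqn v l : ccvg v l -> (fun n => sqn (v n)) @ \oo --> sqn l.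
Proof. by move=> [v1 v2]; apply: cvgD; apply: cvgM. Qed.

End Convergence.

(** * Fatou's lemma for the squared norm *)

Section L2_limits.
Variables (R : realType) (mu : {measure set (measurableTypeR R) -> \bar R}).
Implicit Types f g h : R -> R[i].
Local Notation L2 := (L2 mu).
Local Notation energy := (energy mu).

Lemma limn_einf_le (u : (\bar R)^nat) (c : \bar R) (n0 : nat) :
  (forall n, (n0 <= n)%N -> (u n <= c)%E) -> (limn_einf u <= c)%E.
Proof.
move=> uc; rewrite limn_einf_lim; apply: lime_le; first exact: is_cvg_einfs.
apply: nearW => n; apply: le_trans (uc (maxn n n0) (leq_maxr _ _)).
by apply: ereal_inf_lbound; exists (maxn n n0) => //=; exact: leq_maxl.
Qed.

(** Membership of the limit in [L2] is part of the conclusion, so a pointwise limit can be used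
    before it is known to be square-integrable. Asking for the bound from [n0] on lets it be applied
    to tails of Cauchy or minimizing sequences. *)
Lemma fatou_energy (u_ : nat -> R -> R[i]) u (c : R) (n0 : nat) :
  (forall n, L2 (u_ n)) -> borel_fun u ->
  {ae mu, forall x, ccvg (u_^~ x) (u x)} ->
  (forall n, (n0 <= n)%N -> energy (u_ n) <= c) ->
  L2 u /\ energy u <= c.
Proof.
move=> Lu bu uu uc.
have mu_ n : measurable_fun [set: measurableTypeR R]
    (fun x => (sqn (u_ n x))%:E).
  by apply/measurable_EFinP; apply: borel_sqn; exact: L2_borel (Lu n).
have le_c : (\int[mu]_x (sqn (u x))%:E <= c%:E)%E.
  rewrite (@ge0_ae_eq_integral _ _ _ mu setT _
    (fun x => limn_einf (fun n => (sqn (u_ n x))%:E)))//.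
  - apply: le_trans (fatou mu measurableT mu_ _) _.
      by move=> n x _; rewrite lee_fin sqn_ge0.
    apply: (@limn_einf_le _ _ n0) => n /uc.
    by rewrite -lee_fin energyE.
  - by apply/measurable_EFinP; exact: borel_sqn.
  - under eq_fun do rewrite -[limn_einf _]oppeK -limn_esupN.
    apply: measurableT_comp => //; apply: measurable_fun_limn_esup => n.
    exact: measurableT_comp.
  - by move=> x _; rewrite lee_fin sqn_ge0.
  - move=> x _; rewrite limn_einf_lim; apply: lime_ge; first exact: is_cvg_einfs.
    apply: nearW => n; apply: le_ereal_inf_tmp => _ [m _ <-].
    by rewrite lee_fin sqn_ge0.
  - apply: ae_sub uu => x ux _.
    have : (fun n => (sqn (u_ n x))%:E) @ \oo --> (sqn (u x))%:E.
      by apply: cvg_EFin; [exact: nearW|exact: ccvg_sqn].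
    by move=> /cvg_limn_einf_sup[-> _].
have iu : (\int[mu]_x (sqn (u x))%:E < +oo)%E by exact: le_lt_trans (ltry c).
have Lu' : L2 u.
  apply/L2P; split => //; apply/integrableP; split.
    by apply/measurable_EFinP; exact: borel_sqn.
  apply: le_lt_trans iu; rewrite le_eqVlt; apply/orP; left; apply/eqP.
  by apply: eq_integral => x _ /=; rewrite ger0_norm// sqn_ge0.
by split=> //; rewrite -lee_fin energyE.
Qed.

Lemma aeq_energy f g : borel_fun f -> borel_fun g -> aeq mu f g ->
  energy f = energy g.
Proof.
move=> bf bg fg; apply: (congr1 fine); apply: ge0_ae_eq_integral => //.
- by apply/measurable_EFinP; exact: borel_sqn.
- by apply/measurable_EFinP; exact: borel_sqn.
- by move=> x _; rewrite lee_fin sqn_ge0.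
- by move=> x _; rewrite lee_fin sqn_ge0.
- by apply: ae_sub fg => x ->.
Qed.

End L2_limits.

(** * Reproducing kernel subspaces: completeness, projection, closed graph *)

Section RK_spaces.
Variables (R : realType) (mu : {measure set (measurableTypeR R) -> \bar R}).
Variables (U : set R) (H : set (R -> R[i])).
Hypothesis (HRK : RK_subspace mu U H).
Implicit Types f g h : R -> R[i].
Local Notation L2 := (L2 mu).
Local Notation energy := (energy mu).

Lemma RK_L2 f : H f -> L2 f.
Proof. by case: HRK => H1 _ _ _ /H1[]. Qed.

Lemma RK_out f x : H f -> ~ U x -> f x = 0.
Proof. by case: HRK => H1 _ _ _ /H1[+ _]; apply. Qed.

Lemma RK_lin (a : R[i]) f g : H f -> H g -> H (fun x => a * f x + g x).
Proof. by case: HRK => _ [_ +] _ _; apply. Qed.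

Lemma RK_0 : H (fun=> 0). Proof. by case: HRK => _ []. Qed.

Lemma RK_D f g : H f -> H g -> H (fun x => f x + g x).
Proof.
move=> Hf Hg; have := RK_lin 1 Hf Hg.
by under eq_fun do rewrite mul1r.
Qed.

Lemma RK_Z (a : R[i]) f : H f -> H (fun x => a * f x).
Proof.
move=> Hf; have := RK_lin a Hf RK_0.
by under eq_fun do rewrite addr0.
Qed.

Lemma RK_B f g : H f -> H g -> H (fun x => f x - g x).
Proof.
move=> Hf Hg; have := RK_D Hf (RK_Z (-1) Hg).
by under eq_fun do rewrite mulN1r.
Qed.

Lemma RK_sum n (c : 'I_n -> R[i]) (f_ : 'I_n -> R -> R[i]) :
  (forall i, H (f_ i)) -> H (fun x => \sum_i c i * f_ i x).
Proof.
elim: n => [|n IH] in c f_ * => Hf.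
  by under eq_fun do rewrite big_ord0; exact: RK_0.
under eq_fun do rewrite big_ord_recl.
by apply: RK_lin => //; apply: (IH (fun i => c (lift ord0 i))) => i; exact: Hf.
Qed.

(** Functions of [H] vanish off [U], so a bound exists at every real [k]; pointwise limits can then
    be taken on the whole line. *)
Lemma eval_bound k : exists2 M : R, 0 <= M &
  forall f, H f -> sqn (f k) <= M * energy f.
Proof.
have [Uk|nUk] := pselect (U k); last first.
  by exists 0 => // f Hf; rewrite (RK_out Hf nUk) /sqn /= mul0r; lra.
case: HRK => _ _ _ /(_ k Uk)[M HM]; exists (M ^+ 2); first exact: sqr_ge0.
move=> f /HM; rewrite norm_rcE lecR => fM.
rewrite -(sqr_sqrtr (sqn_ge0 (f k))) -L2norm_sqr -exprMn.
by rewrite ler_sqr ?nnegrE ?sqrtr_ge0// (le_trans _ fM) ?sqrtr_ge0.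
Qed.

Lemma eval_cvg (x_ : nat -> R -> R[i]) (x : R -> R[i]) (r : nat -> R) k :
  (forall n, H (x_ n)) -> H x ->
  (forall n, energy (fun t => x_ n t - x t) <= r n) ->
  r @ \oo --> 0 -> ccvg (x_^~ k) (x k).
Proof.
move=> Hx_ Hx xr r0; have [M M0 HM] := eval_bound k.
apply: (@sqn_le_ccvg _ _ _ (fun n => M * r n)).
  move=> n; apply: le_trans (HM _ (RK_B (Hx_ n) Hx)) _.
  by rewrite ler_wpM2l.
by rewrite -(mulr0 M); exact: cvgMl_tmp.
Qed.

(** Bounded evaluations turn a Cauchy sequence into one converging at every point; the limit is
    Borel, and Fatou's lemma passes the rate [r] on to it. Closedness of [H] yields only an element
    almost everywhere equal to this limit, which has the same distances. *)
Lemma RK_complete (x_ : nat -> R -> R[i]) (r : nat -> R) :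
  (forall n, H (x_ n)) ->
  (forall n m, (n <= m)%N -> energy (fun t => x_ m t - x_ n t) <= r n) ->
  r @ \oo --> 0 ->
  exists2 h, H h & forall n, energy (fun t => h t - x_ n t) <= r n.
Proof.
move=> Hx xr r0.
have /choice[x xx] : forall k, exists l, ccvg (x_^~ k) l.
  move=> k; have [M M0 HM] := eval_bound k.
  apply: (@sqn_cauchy_ccvg _ _ (fun n => M * r n)).
    move=> n m nm; apply: le_trans (HM _ (RK_B (Hx m) (Hx n))) _.
    by rewrite ler_wpM2l// xr.
  by rewrite -(mulr0 M); exact: cvgMl_tmp.
have bx : borel_fun x.
  split.
    apply: (@measurable_fun_cvg _ _ _ _ (fun n t => complex.Re (x_ n t))).
      by move=> n; have [] := L2_borel (RK_L2 (Hx n)).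
    by move=> t _; exact: (xx t).1.
  apply: (@measurable_fun_cvg _ _ _ _ (fun n t => complex.Im (x_ n t))).
    by move=> n; have [] := L2_borel (RK_L2 (Hx n)).
  by move=> t _; exact: (xx t).2.
have xn n : L2 (fun t => x t - x_ n t) /\ energy (fun t => x t - x_ n t) <= r n.
  apply: (@fatou_energy _ mu (fun m t => x_ m t - x_ n t) _ _ n).
  - by move=> m; apply: RK_L2; exact: RK_B.
  - have := borel_lin (-1) (L2_borel (RK_L2 (Hx n))) bx.
    by under eq_fun do rewrite mulN1r addrC.
  - apply: aeW => t /=; have := ccvg_lin 1 (- x_ n t) (xx t).
    by rewrite mul1r; under eq_fun do rewrite mul1r.
  - by move=> m /xr.
have Lx : L2 x.
  have := L2D (xn 0%N).1 (RK_L2 (Hx 0%N)).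
  by under eq_fun do rewrite subrK.
case: HRK => _ _ /(_ x_ x Hx Lx) + _.
case.
  apply: (@sqr_le_cvg _ _ r) r0 => n.
  by rewrite subr0 L2norm_sqr energyC (xn n).2.
move=> h Hh hx; exists h => // n.
rewrite (@aeq_energy _ _ _ (fun t => x t - x_ n t)); first exact: (xn n).2.
- by apply: L2_borel; exact: RK_L2 (RK_B Hh (Hx n)).
- exact: L2_borel (xn n).1.
- by apply: ae_sub hx => t ->.
Qed.

Lemma invn_cvg0 : (fun n => n.+1%:R^-1 : R) @ \oo --> 0.
Proof. exact: cvg_harmonic. Qed.

Lemma projection f : L2 f -> exists2 h, H h &
  forall u, H u -> L2dot mu u (fun t => f t - h t) = 0.
Proof.
move=> Lf.
pose S := [set energy (fun t => f t - h t) | h in H].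
have S0 : S !=set0 by exists (energy (fun t => f t - 0)), (fun=> 0) => //; exact: RK_0.
have lbS : has_lbound S by exists 0 => _ [h _ <-]; exact: energy_ge0.
have infS : has_inf S by [].
pose d := inf S.
have dS h : H h -> d <= energy (fun t => f t - h t).
  by move=> Hh; apply: ge_inf => //; exists h.
have /choice[x Hx] : forall n, exists h, H h /\
    energy (fun t => f t - h t) <= d + n.+1%:R^-1.
  move=> n; have [|_ [h Hh <-] /ltW le] := inf_adherent (eps := n.+1%:R^-1) _ infS.
    by rewrite invr_gt0.
  by exists h.
(* The parallelogram law at the midpoint of [x n] and [x m], whose squared distance to [f] is at
   least [d]: $2(d+\frac1{n+1})+2(d+\frac1{m+1})-4d\le\frac4{n+1}$. *)
have parallel n m : (n <= m)%N ->
    energy (fun t => x m t - x n t) <= 4 * n.+1%:R^-1.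
  move=> nm.
  have [Ln Lm] := (L2B Lf (RK_L2 (Hx n).1), L2B Lf (RK_L2 (Hx m).1)).
  have mn : m.+1%:R^-1 <= n.+1%:R^-1 :> R by rewrite lef_pV2 ?posrE// ler_nat.
  have /dS : H (fun t => 2^-1 * (x m t + x n t)).
    by apply: RK_Z; exact: RK_D (Hx m).1 (Hx n).1.
  have -> : (fun t => f t - 2^-1 * (x m t + x n t)) =
      (fun t => 2^-1 * ((f t - x n t) + (f t - x m t))).
    by apply/funext => t; field.
  rewrite energyZ; last exact: L2D.
  rewrite (energyD Ln Lm).
  have -> : (fun t => x m t - x n t) =
      (fun t => (f t - x n t) - (f t - x m t)).
    by apply/funext => t; ring.
  rewrite (energyB Ln Lm).
  have -> : sqn (2^-1 : R[i]) = 4^-1.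
    have -> : 2^-1 = (2^-1)%:C :> R[i] by rewrite fmorphV rmorph_nat.
    by rewrite sqn_rc; field.
  have := (Hx n).2; have := (Hx m).2.
  move: (n.+1%:R^-1) (m.+1%:R^-1) mn => e1 e2; lra.
have [|h Hh hx] := RK_complete (fun n => (Hx n).1) parallel.
  by rewrite -(mulr0 4); apply: cvgMl_tmp; exact: invn_cvg0.
exists h => //.
(* The infimum is attained at [h]: Fatou's lemma along the tail where $1/(n+1)<e$ gives [d + e] for
   every positive [e]. *)
have [_ hd] : L2 (fun t => f t - h t) /\ energy (fun t => f t - h t) <= d.
  have H1 e : 0 < e ->
     L2 (fun t => f t - h t) /\ energy (fun t => f t - h t) <= d + e.
    move=> e0.
    have [n0 _ n0e] := near_lt invn_cvg0 e0.
    apply: (@fatou_energy _ mu (fun n t => f t - x n t) _ _ n0).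
    - by move=> n; apply: L2B => //; exact: RK_L2 (Hx n).1.
    - by apply: L2_borel; exact: L2B Lf (RK_L2 Hh).
    - apply: aeW => t.
      have H2 : ccvg (x^~ t) (h t).
        apply: (@eval_cvg x h (fun n => 4 * n.+1%:R^-1)) => //.
        + by move=> n; exact: (Hx n).1.
        + by move=> n; rewrite energyC.
        + by rewrite -(mulr0 4); apply: cvgMl_tmp; exact: invn_cvg0.
      have := ccvg_lin (-1) (f t) H2.
      rewrite mulN1r addrC; under eq_fun do rewrite mulN1r addrC.
      exact.
    - move=> n /n0e/= /ltW ne; apply: le_trans (Hx n).2 _; exact: lerD.
  split; first exact: (H1 1 ltr01).1.
  by apply/Num.Theory.ler_addgt0Pr => e /H1[].
move=> u Hu; have Lu := RK_L2 Hu.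
have Lfh := L2B Lf (RK_L2 Hh).
set z := L2dot mu u _.
(* Minimality of [h] tested against the competitor $h-au$. *)
have var (a : R[i]) : 0 <= sqn a * energy u + 2 * complex.Re (a * z).
  have /dS : H (fun t => - a * u t + h t) by exact: RK_lin.
  have -> : (fun t => f t - (- a * u t + h t)) =
      (fun t => a * u t + (f t - h t)) by apply/funext => t; ring.
  rewrite energy_lin// -/z; lra.
clearbody z; have E0 := energy_ge0 mu u.
have s0 : 0 < (energy u + 1)^-1 by rewrite invr_gt0 ltr_wpDl.
apply: sqn_eq0; apply/eqP; rewrite eq_le sqn_ge0 andbT.
(* With $s=1/(\|u\|^2+1)$ and $a=-s\bar z$ the variation equals $-s|z|^2(1+s)$, which is negative
   unless z is 0. The added 1 covers the case $\|u\|=0$. *)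
have := var ((- (energy u + 1)^-1)%:C * z^*).
have -> : sqn ((- (energy u + 1)^-1)%:C * z^*) = (energy u + 1)^-1 ^+ 2 * sqn z.
  by rewrite /sqn !cE; ring.
have -> : complex.Re ((- (energy u + 1)^-1)%:C * z^* * z) =
    - ((energy u + 1)^-1 * sqn z) by rewrite /sqn !cE; ring.
have sE : (energy u + 1)^-1 * (energy u + 1) = 1 by rewrite mulVf// gt_eqF// ltr_wpDl.
set s := (energy u + 1)^-1 in s0 sE *.
have -> : s ^+ 2 * sqn z * energy u + 2 * - (s * sqn z) =
   s * sqn z * (s * (energy u + 1) - s - 2) by ring.
rewrite sE => H1; rewrite leNgt; apply/negP => z0.
have := mulr_gt0 s0 z0; nra.
Qed.

(* If T were unbounded, every ball would contain a point with energy (T y) > n;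
   by Fatou's lemma this persists on a smaller ball, and the centres of nested
   balls converge to some h with energy (T h) > n for all n. *)
Lemma closed_graph (T : (R -> R[i]) -> R -> R[i]) :
  (forall f, H f -> L2 (T f)) ->
  (forall (a : R[i]) f g, H f -> H g ->
    T (fun x => a * f x + g x) = (fun x => a * T f x + T g x)) ->
  (forall (x_ : nat -> R -> R[i]) x, (forall n, H (x_ n)) -> H x ->
    (forall k, ccvg (x_^~ k) (x k)) ->
    {ae mu, forall k, ccvg (fun n => T (x_ n) k) (T x k)}) ->
  exists2 B : R, 0 <= B & forall f, H f -> energy (T f) <= B * energy f.
Proof.
move=> LT Tlin Tclosed; apply: contrapT => unbounded.
have T0 : T (fun=> 0) = (fun=> 0).
  have := Tlin 1 _ _ RK_0 RK_0; under eq_fun do rewrite mulr0 addr0.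
  move=> T2; apply/funext => x; have := congr1 (@^~ x) T2.
  by rewrite /= mul1r -[X in X = _]addr0 => /addrI <-.
have TZ (a : R[i]) f : H f -> T (fun x => a * f x) = (fun x => a * T f x).
  move=> Hf; have := Tlin a f _ Hf RK_0; rewrite T0.
  by under eq_fun do rewrite addr0; under [RHS]eq_fun do rewrite addr0.
have TD f g : H f -> H g -> T (fun x => f x + g x) = (fun x => T f x + T g x).
  move=> Hf Hg; have := Tlin 1 f g Hf Hg.
  by under eq_fun do rewrite mul1r; under [RHS]eq_fun do rewrite mul1r.
have TB f g : H f -> H g -> T (fun x => f x - g x) = (fun x => T f x - T g x).
  move=> Hf Hg; have := TD _ _ Hf (RK_Z (-1) Hg); rewrite TZ//.
  by under eq_fun do rewrite mulN1r; under [RHS]eq_fun do rewrite mulN1r.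
(* Otherwise [T] maps a ball into a ball, and scaling yields the bound [c / rho] on all of [H]. *)
have small (rho c : R) : 0 < rho -> 0 <= c -> exists xi,
    [/\ H xi, energy xi <= rho & c < energy (T xi)].
  move=> rho0 c0; apply: contrapT => nxi; apply: unbounded.
  have bnd xi : H xi -> energy xi <= rho -> energy (T xi) <= c.
    by move=> Hxi Exi; rewrite leNgt; apply/negP => cT; apply: nxi; exists xi.
  have bndZ (t : R) f : H f -> 0 <= t -> t * energy f <= rho ->
      t * energy (T f) <= c.
    move=> Hf t0 tf; have sq : sqn (Num.sqrt t)%:C = t by rewrite sqn_rc sqr_sqrtr.
    have := bnd _ (RK_Z (Num.sqrt t)%:C Hf).
    rewrite TZ// !energyZ ?sq//; [exact|exact: LT|exact: RK_L2].
  exists (c / rho); first by rewrite divr_ge0// ltW.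
  move=> f Hf; have := energy_ge0 mu f; rewrite le_eqVlt => /predU1P[E0|E0].
    (* If [f] has norm 0, all its multiples stay in the ball; the chosen factor makes the squared
       norm of the image equal to [c + 1], exceeding [c]. *)
    rewrite -E0 mulr0 leNgt; apply/negP => T0'.
    have t0 : 0 <= (c + 1) / energy (T f) by rewrite divr_ge0 ?addr_ge0// ltW.
    have := bndZ _ f Hf t0; rewrite -E0 mulr0 divfK ?gt_eqF//.
    move=> /(_ (ltW rho0)); lra.
  have t0 : 0 <= rho / energy f by rewrite divr_ge0 ?ltW.
  have := bndZ _ f Hf t0; rewrite divfK ?gt_eqF// => /(_ (lexx _)) H1.
  have -> : energy (T f) = rho / energy f * energy (T f) * (energy f / rho).
    by field; rewrite !gt_eqF.
  have -> : c / rho * energy f = c * (energy f / rho) by rewrite mulrAC mulrA.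
  by apply: ler_wpM2r => //; rewrite divr_ge0// ltW.
have opn x (c : R) : H x -> c < energy (T x) -> exists2 r : R, 0 < r &
    forall y, H y -> energy (fun t => y t - x t) <= r -> c < energy (T y).
  move=> Hx cx; apply: contrapT => nr.
  have /choice[y Hy] : forall j, exists y, [/\ H y,
      energy (fun t => y t - x t) <= j.+1%:R^-1 & energy (T y) <= c].
    move=> j; apply: contrapT => ny; apply: nr; exists j.+1%:R^-1.
      by rewrite invr_gt0.
    move=> y Hy yx; rewrite ltNge; apply/negP => Tyc; apply: ny.
    by exists y.
  have Hyj j : H (y j) by have [] := Hy j.
  have yc k : ccvg (y^~ k) (x k).
    by apply: (eval_cvg k Hyj Hx _ invn_cvg0) => n; have [] := Hy n.
  have [||j _|_] := @fatou_energy _ mu (fun j => T (y j)) _ c 0 _ _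
    (Tclosed _ _ Hyj Hx yc).
  - by move=> j; exact: LT.
  - exact: L2_borel (LT _ Hx).
  - by have [] := Hy j.
  - by rewrite leNgt cx.
pose good (s : (R -> R[i]) * R) := H s.1 /\ 0 < s.2.
(* Radii bound squared distances. Division by 4 is what nesting requires: $2\cdot\frac
   r4+2\cdot\frac r4=r$ in [energyB_le]. The premise [good] only makes the choice function total. *)
have /choice[F HF] : forall ns : nat * ((R -> R[i]) * R), exists s',
    good ns.2 -> [/\ good s', s'.2 <= ns.2.2 / 4,
      energy (fun t => s'.1 t - ns.2.1 t) <= ns.2.2 / 4 &
      forall y, H y -> energy (fun t => y t - s'.1 t) <= s'.2 ->
        ns.1%:R < energy (T y)].
  move=> [n [x r]] /=; have [[Hx r0]|ng] := pselect (good (x, r)); last first.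
    by exists (x, r).
  have r40 : 0 < r / 4 by rewrite divr_gt0.
  have [xi [Hxi xir Txi]] := small (r / 4) n%:R r40 (ler0n _ _).
  have [x' [Hx' xx' nx']] : exists x', [/\ H x',
      energy (fun t => x' t - x t) <= r / 4 & n%:R < energy (T x')].
    (* One of $x+\xi$ and $x-\xi$ works, since the squared norms of their images add up to
       $2\|Tx\|^2+2\|T\xi\|^2>2n$. *)
    have [le1|] := leP (energy (T (fun t => x t + xi t))) n%:R; last first.
      exists (fun t => x t + xi t); split => //; first exact: RK_D.
      by under eq_fun do rewrite addrC addKr.
    exists (fun t => x t - xi t); split => //; first exact: RK_B.
      rewrite energyC; under eq_fun do rewrite opprB addrC subrK.
      done.
    have := energyB (LT _ Hx) (LT _ Hxi); have := energyD (LT _ Hx) (LT _ Hxi).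
    rewrite -TD// -TB//; have := energy_ge0 mu (T x).
    move: (n%:R) Txi le1 => N; lra.
  have [r' r'0 Hr'] := opn x' n%:R Hx' nx'.
  exists (x', Num.min r' (r / 4)) => _; split => //=.
  - by split => //=; rewrite lt_min r'0.
  - by rewrite ge_min lexx orbT.
  - by move=> y Hy; rewrite le_min => /andP[/(Hr' _ Hy)].
pose s := fix s n := if n is m.+1 then F (m, s m) else ((fun=> 0), 1) : (R -> R[i]) * R.
have sg n : good (s n).
  elim: n => [|n IH]; first by split => /=; [exact: RK_0|exact: ltr01].
  by have [] := HF (n, s n) IH.
have sS n : [/\ (s n.+1).2 <= (s n).2 / 4,
      energy (fun t => (s n.+1).1 t - (s n).1 t) <= (s n).2 / 4 &
      forall y, H y -> energy (fun t => y t - (s n.+1).1 t) <= (s n.+1).2 ->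
        n%:R < energy (T y)].
  by have [] := HF (n, s n) (sg n).
have nest n d y : H y -> energy (fun t => y t - (s (n + d)%N).1 t) <= (s (n + d)%N).2 ->
    energy (fun t => y t - (s n).1 t) <= (s n).2.
  move=> Hy; elim: d => [|d IH]; first by rewrite addn0.
  rewrite addnS => yd; apply: IH; have [r1 r2 _] := sS (n + d)%N.
  have := energyB_le (RK_L2 Hy) (RK_L2 (sg (n + d).+1).1) (RK_L2 (sg (n + d)%N).1).
  have := (sg (n + d)%N).2; lra.
have [||h Hh hs] := @RK_complete (fun n => (s n).1) (fun n => (s n).2)
    (fun n => (sg n).1).
- move=> n m /subnKC <-; apply: (@nest n (m - n)%N).
    exact: (sg (n + (m - n))%N).1.
  under eq_fun do rewrite subrr.
  by rewrite (aeq_energy0 (borel_cst 0))//; [exact: ltW (sg _).2|exact: aeW].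
- apply: (squeeze_cvgr _ (cvg_cst 0) invn_cvg0); apply: nearW => n.
  rewrite (ltW (sg n).2)/=; elim: n => [|n IH]; first by rewrite invr1.
  have [r1 _ _] := sS n; apply: le_trans r1 _.
  apply: (@le_trans _ _ (n.+1%:R^-1 / 4)); first by rewrite ler_pM2r.
  rewrite -invfM lef_pV2 ?posrE ?mulr_gt0// -natrM ler_nat.
  by rewrite mulnC; lia.
(* The limit [h] lies in every ball, so its image has squared norm above every integer. *)
have := archi_boundP (energy_ge0 mu (T h)).
have [_ _ /(_ h Hh (hs _))] := sS (Num.bound (energy (T h))).
by move=> /lt_trans h1 /h1; rewrite ltxx.
Qed.

End RK_spaces.

(** * Division by x - p and local bounds on the evaluations *)

Section Division.
Variables (R : realType) (mu : {measure set (measurableTypeR R) -> \bar R}).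
Variables (U : set R) (H : set (R -> R[i])).
Hypotheses (HRK : RK_subspace mu U H) (mu_atomless : without_atoms mu).
Hypotheses (H_sep : separates_zeros U H) (H_div : division_property U H).
Implicit Types f g h : R -> R[i].
Local Notation L2 := (L2 mu).
Local Notation energy := (energy mu).

(** This is where atomlessness enters: division by x - p gives no information at p, and a single
    point is a null set. *)
Lemma ae_neq (P : R -> Prop) (p : R) : (forall x, x <> p -> P x) ->
  {ae mu, forall x, P x}.
Proof.
move=> Pp; exists [set p]; split; [exact: measurable_set1|exact: mu_atomless|].
by move=> x /= nP; apply: contrapT => /Pp.
Qed.

(** Off [p] the factor cancels, so [h] vanishes almost everywhere and has norm 0; the bounded
    evaluations then force it to vanish at [p] too. This makes quotients unique. *)
Lemma mul_sub_inj p h : H h -> (forall x, U x -> h x * (x - p)%:C = 0) ->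
  h = (fun=> 0).
Proof.
move=> Hh hp.
have h0 x : x <> p -> h x = 0.
  move=> xp; have [Ux|] := pselect (U x); last exact: (RK_out HRK Hh).
  move/eqP: (hp x Ux); rewrite mulf_eq0 => /orP[/eqP//|/eqP[/eqP]].
  by rewrite subr_eq0 => /eqP.
have E0 : energy h = 0.
  apply: aeq_energy0; first exact: L2_borel (RK_L2 HRK Hh).
  exact: (@ae_neq _ p).
apply/funext => x; have [M _ /(_ _ Hh)] := eval_bound HRK x.
by rewrite E0 mulr0 => hx; apply/sqn_eq0/eqP; rewrite eq_le hx sqn_ge0.
Qed.

Section at_point.
Variables (p : R) (g : R -> R[i]).
Hypotheses (Up : U p) (Hg : H g) (gp : g p <> 0).

(* The difference quotient of f/g at p, multiplied back by g. *)
Lemma ex_diffq f : exists h, H f -> H h /\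
  forall x, U x -> h x * (x - p)%:C = f x - f p / g p * g x.
Proof.
have [Hf|nHf] := pselect (H f); last by exists f.
have Hd : H (fun x => - (f p / g p) * g x + f x) by exact: (RK_lin HRK).
have dp : - (f p / g p) * g p + f p = 0.
  by rewrite mulNr divfK ?addNr//; exact/eqP.
have [h Hh hx] := H_div Up Hd dp.
by exists h => _; split => // x /hx ->; rewrite mulNr addrC.
Qed.

Definition diffq f := projT1 (cid (ex_diffq f)).

Lemma diffq_H f : H f -> H (diffq f).
Proof. by move=> Hf; have [] := projT2 (cid (ex_diffq f)) Hf. Qed.

Lemma diffqE f x : H f -> U x ->
  diffq f x * (x - p)%:C = f x - f p / g p * g x.
Proof. by move=> Hf; have [_] := projT2 (cid (ex_diffq f)) Hf; apply. Qed.

(** The quotients are chosen separately for each function; their uniqueness makes the choice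
    linear. *)
Lemma diffq_lin (a : R[i]) f1 f2 : H f1 -> H f2 ->
  diffq (fun x => a * f1 x + f2 x) = (fun x => a * diffq f1 x + diffq f2 x).
Proof.
move=> H1 H2; have H12 := RK_lin HRK a H1 H2.
have Hd := RK_lin HRK a (diffq_H H1) (diffq_H H2).
suff : (fun x => diffq (fun x => a * f1 x + f2 x) x -
    (a * diffq f1 x + diffq f2 x)) = (fun=> 0).
  move=> /funeqP d0; apply/funext => x; apply/eqP.
  by rewrite -subr_eq0; apply/eqP; exact: d0.
apply: (@mul_sub_inj p); first exact: (RK_B HRK (diffq_H H12) Hd).
move=> x Ux; rewrite mulrBl mulrDl -mulrA !diffqE//.
by ring.
Qed.

(** The coefficients of [f x] and [f p] do not depend on [f], so pointwise convergence passes to the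
    quotients away from [p]. *)
Lemma diffq_neq f x : H f -> U x -> x <> p ->
  diffq f x = (x - p)%:C^-1 * f x + (- (x - p)%:C^-1 * g x / g p) * f p.
Proof.
move=> Hf Ux xp; have xp0 : (x - p)%:C != 0 :> R[i].
  by apply/eqP => -[/eqP]; rewrite subr_eq0 => /eqP.
apply: (mulIf xp0); rewrite diffqE//.
have g0 : g p != 0 by exact/eqP.
by move: (x - p)%:C xp0 => d d0; field; exact/andP.
Qed.

Lemma diffq_closed (x_ : nat -> R -> R[i]) f : (forall n, H (x_ n)) -> H f ->
  (forall k, ccvg (x_^~ k) (f k)) ->
  {ae mu, forall k, ccvg (fun n => diffq (x_ n) k) (diffq f k)}.
Proof.
move=> Hx Hf xf; apply: (@ae_neq _ p) => x xp.
have [Ux|nUx] := pselect (U x); last first.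
  rewrite (RK_out HRK (diffq_H Hf) nUx).
  under eq_fun do rewrite (RK_out HRK (diffq_H (Hx _)) nUx).
  by split; exact: cvg_cst.
under eq_fun do rewrite diffq_neq//.
by rewrite diffq_neq//; apply: ccvg_comb.
Qed.

Lemma diffq_bounded : exists2 B : R, 0 <= B &
  forall f, H f -> energy (diffq f) <= B * energy f.
Proof.
apply: (closed_graph HRK).
- by move=> f Hf; apply: (RK_L2 HRK); exact: diffq_H.
- exact: diffq_lin.
- exact: diffq_closed.
Qed.

(* Iterating f(k) = f(p)/g(p) g(k) + (k - p) (diffq f)(k): near p every bound s
   of the evaluation at k improves to A |g(k)|^2 + s/2. *)
Lemma eval_local_bound : exists delta C : R, [/\ 0 < delta, 0 <= C &
  forall k, U k -> `|k - p| < delta -> forall f, H f ->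
    sqn (f k) <= C * sqn (g k) * energy f].
Proof.
have [B B0 HB] := diffq_bounded; have [M M0 HM] := eval_bound HRK p.
(* The factor 2 is that of $|a+b|^2\le2|a|^2+2|b|^2$; the quotient bounds $|f(p)/g(p)|^2$ by a
   multiple of the squared norm of [f]. *)
pose A := 2 * (M / sqn (g p)).
have g0 : 0 < sqn (g p).
  by rewrite lt_def sqn_ge0 andbT; apply/eqP => /sqn_eq0.
have A0 : 0 <= A by rewrite mulr_ge0// divr_ge0// ltW.
(* Chosen so that $2(k-p)^2B\le\frac12$: the bound by 1 gives $(k-p)^2\le|k-p|$, and [B + 1] avoids
   dividing by 0. *)
pose delta := Num.min 1 (4 * (B + 1))^-1.
exists delta, (2 * A); split.
- by rewrite lt_min ltr01 invr_gt0 mulr_gt0// ltr_wpDl.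
- exact: mulr_ge0.
move=> k Uk kp; have [Mk Mk0 HMk] := eval_bound HRK k.
have kp2 : 2 * (k - p) ^+ 2 * B <= 2^-1.
  move: kp; rewrite lt_min => /andP[kp1 kpB].
  have B1 : 0 < B + 1 by rewrite ltr_wpDl.
  have h1 : `|k - p| * (4 * (B + 1)) <= 1.
    by rewrite -ler_pdivlMr ?mulr_gt0// mul1r ltW.
  rewrite -(real_normK (num_real (k - p))).
  have := normr_ge0 (k - p); move: `|k - p| kp1 h1 => t *.
  have : t * t * B <= t * B by rewrite ler_wpM2r// ler_piMr// ltW.
  have : 0 <= t * B by exact: mulr_ge0.
  lra.
have step s : 0 <= s -> (forall f, H f -> sqn (f k) <= s * energy f) ->
    forall f, H f -> sqn (f k) <= (A * sqn (g k) + s / 2) * energy f.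
  move=> s0 Hs f Hf.
  have -> : f k = f p / g p * g k + diffq f k * (k - p)%:C.
    by rewrite diffqE// addrC subrK.
  apply: le_trans (sqnD_le _ _) _; rewrite [leRHS]mulrDl; apply: lerD.
    rewrite !sqnM sqnV /A -!mulrA ler_pM2l//.
    have -> : M * ((sqn (g p))^-1 * (sqn (g k) * energy f)) =
      M * energy f * ((sqn (g p))^-1 * sqn (g k)) by ring.
    apply: ler_wpM2r; first by rewrite mulr_ge0 ?invr_ge0 ?sqn_ge0.
    exact: HM.
  rewrite sqnM sqn_rc.
  have E0 := energy_ge0 mu f.
  have h1 : sqn (diffq f k) <= s * (B * energy f).
    apply: le_trans (Hs _ (diffq_H Hf)) _; apply: ler_wpM2l => //; exact: HB.
  have -> : 2 * (sqn (diffq f k) * (k - p) ^+ 2) =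
    2 * (k - p) ^+ 2 * sqn (diffq f k) by ring.
  apply: (@le_trans _ _ (2 * (k - p) ^+ 2 * (s * (B * energy f)))).
    by apply: ler_wpM2l => //; rewrite mulr_ge0// sqr_ge0.
  have -> : 2 * (k - p) ^+ 2 * (s * (B * energy f)) =
    2 * (k - p) ^+ 2 * B * (s * energy f) by ring.
  have -> : s / 2 * energy f = 2^-1 * (s * energy f) by ring.
  by apply: ler_wpM2r => //; exact: mulr_ge0.
(* The value $2A|g(k)|^2$ is the fixed point of $s\mapsto A|g(k)|^2+s/2$. The excess is really
   halved each time; $1/(n+1)$ is a weaker rate that still tends to 0. *)
have iter n f : H f ->
    sqn (f k) <= (2 * A * sqn (g k) + Mk * n.+1%:R^-1) * energy f.
  elim: n f => [|n IH] f Hf.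
    apply: le_trans (HMk _ Hf) _; apply: ler_wpM2r; first exact: energy_ge0.
    rewrite invr1 mulr1 lerDr; apply: mulr_ge0; last exact: sqn_ge0.
    exact: mulr_ge0.
  have pos : 0 <= 2 * A * sqn (g k) + Mk * n.+1%:R^-1.
    apply: addr_ge0; last by rewrite mulr_ge0.
    by rewrite mulr_ge0 ?sqn_ge0// mulr_ge0.
  apply: le_trans (step _ pos IH f Hf) _.
  apply: ler_wpM2r; first exact: energy_ge0.
  rewrite mulrDl addrA; apply: lerD.
    by have := mulr_ge0 A0 (sqn_ge0 (g k)); lra.
  rewrite -mulrA; apply: ler_wpM2l => //.
  rewrite -invfM lef_pV2 ?posrE ?mulr_gt0// -natrM ler_nat; lia.
move=> f Hf; apply/Num.Theory.ler_addgt0Pr => e e0.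
have ME : (fun n => Mk * energy f * n.+1%:R^-1 : R) @ \oo --> 0.
  by rewrite -(mulr0 (Mk * energy f)); apply: cvgMl_tmp; exact: invn_cvg0.
have [n _ /(_ n (leqnn n)) /ltW ne] := near_lt ME e0.
apply: le_trans (iter n f Hf) _; rewrite mulrDl lerD2l.
by rewrite mulrAC.
Qed.

End at_point.

(** Near each p the majorant is $C|g|^2$ with g in [H], hence integrable; [G] adds these over the
    centres of a finite subcover. *)
Lemma eval_compact_bound (Om : set R) : compact Om -> Om `<=` U ->
  exists G : R -> R, [/\ rint mu G, forall x, 0 <= G x &
    forall x f, Om x -> H f -> sqn (f x) <= G x * energy f].
Proof.
move=> cOm OmU.
have loc p : exists t : R * (R -> R), U p -> [/\ 0 < t.1, rint mu t.2,
    forall x, 0 <= t.2 x & forall x f, U x -> `|x - p| < t.1 -> H f ->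
      sqn (f x) <= t.2 x * energy f].
  have [Up|nUp] := pselect (U p); last by exists (0, fun=> 0).
  have [g Hg gp] := H_sep Up.
  have [delta [C [d0 C0 dC]]] := eval_local_bound Up Hg gp.
  exists (delta, fun x => C * sqn (g x)) => _; split => //=.
  - by apply: rintZ; exact: L2_int (RK_L2 HRK Hg).
  - by move=> x; rewrite mulr_ge0// sqn_ge0.
  - by move=> x f Ux xd Hf; exact: dC.
have /choice[t Ht] := loc.
move: cOm; rewrite compact_cover => /(_ R Om (fun p => ball p (t p).1)).
case.
- by move=> p _; exact: ball_open.
- move=> x Omx; exists x => //; apply: ballxx.
  by have [] := Ht x (OmU _ Omx).
move=> D DOm Dcov.
have Du p : p \in finmap.enum_fset D -> U p by move=> /DOm /set_mem /OmU.
exists (fun x => \sum_(p <- finmap.enum_fset D) (t p).2 x); split.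
- by apply: rint_sum => p /Du /Ht[].
- by move=> x; rewrite big_seq sumr_ge0// => p /Du /Ht[].
move=> x f Omx Hf; have [p pD xp] := Dcov _ Omx.
have [_ _ t0 tx] := Ht p (Du p pD).
apply: le_trans (tx x f (OmU _ Omx) _ Hf) _.
  by move: xp; rewrite /ball/= distrC.
apply: ler_wpM2r; first exact: energy_ge0.
rewrite (big_rem p)//= lerDl big_seq sumr_ge0// => q /mem_rem /Du /Ht[_ _ + _].
exact.
Qed.

End Division.

(** * Finite sums and existence of orthonormal bases *)

Section Sums.
Variables (R : realType) (mu : {measure set (measurableTypeR R) -> \bar R}).
Implicit Types f g h : R -> R[i].
Local Notation L2 := (L2 mu).
Local Notation L2dot := (L2dot mu).

Lemma cint_sum (I : Type) (s : seq I) (a : I -> R[i]) (F : I -> R -> R[i]) :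
  (forall i, cint mu (F i)) -> cint mu (fun x => \sum_(i <- s) a i * F i x).
Proof.
move=> cF; elim: s => [|i s IH]; under eq_fun do rewrite ?big_nil ?big_cons.
  by split; exact: integrable0.
exact: cint_lin.
Qed.

Lemma cintegral0 : cintegral mu setT (fun=> 0) = 0.
Proof.
by apply: eq_complexP; rewrite ?(Re_cintegral, Im_cintegral) Rintegral_cst// mul0r.
Qed.

Lemma cintegral_sum (I : Type) (s : seq I) (a : I -> R[i]) (F : I -> R -> R[i]) :
  (forall i, cint mu (F i)) -> cintegral mu setT (fun x => \sum_(i <- s) a i * F i x) =
  \sum_(i <- s) a i * cintegral mu setT (F i).
Proof.
move=> cF; elim: s => [|i s IH]; under eq_fun do rewrite ?big_nil ?big_cons.
  by rewrite cintegral0 big_nil.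
by rewrite cintegral_lin// ?IH ?big_cons//; exact: cint_sum.
Qed.

Lemma L2_sum (I : Type) (s : seq I) (a : I -> R[i]) (F : I -> R -> R[i]) :
  (forall i, L2 (F i)) -> L2 (fun x => \sum_(i <- s) a i * F i x).
Proof.
move=> LF; elim: s => [|i s IH]; under eq_fun do rewrite ?big_nil ?big_cons.
  exact: L2_0.
exact: L2_lin.
Qed.

Lemma L2dot_suml (I : Type) (s : seq I) (a : I -> R[i]) (F : I -> R -> R[i]) g :
  (forall i, L2 (F i)) -> L2 g ->
  L2dot (fun x => \sum_(i <- s) a i * F i x) g = \sum_(i <- s) a i * L2dot (F i) g.
Proof.
move=> LF Lg; elim: s => [|i s IH]; under eq_fun do rewrite ?big_nil ?big_cons.
  by rewrite L2dot0l big_nil.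
by rewrite L2dot_linl// ?IH ?big_cons//; exact: L2_sum.
Qed.

Lemma L2dot_sumr (I : Type) (s : seq I) (a : I -> R[i]) (F : I -> R -> R[i]) g :
  (forall i, L2 (F i)) -> L2 g ->
  L2dot g (fun x => \sum_(i <- s) a i * F i x) =
  \sum_(i <- s) (a i)^* * L2dot g (F i).
Proof.
move=> LF Lg; elim: s => [|i s IH]; under eq_fun do rewrite ?big_nil ?big_cons.
  by rewrite L2dotC//; [rewrite L2dot0l conjC0 big_nil|exact: L2_0].
by rewrite L2dot_linr// ?IH ?big_cons//; exact: L2_sum.
Qed.

Lemma real_complex_sum (I : finType) (F : I -> R) :
  (\sum_i F i)%:C = \sum_i (F i)%:C.
Proof. exact: rmorph_sum. Qed.

Lemma sum_mul_delta (I : finType) (a : I -> R[i]) (i : I) :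
  \sum_j a j * (j == i)%:R = a i.
Proof.
rewrite (bigD1 i)//= eqxx mulr1 big1 ?addr0// => j /negPf ->.
exact: mulr0.
Qed.

(** Zorn's lemma on orthonormal sets: a function of nonzero norm orthogonal to a maximal one could
    be normalized and added to it. *)
Lemma ex_orthonormal_basis : exists S, orthonormal_basis mu S.
Proof.
pose P S := [/\ S `<=` L2, forall e, S e -> L2dot e e = 1 &
  forall e e', S e -> S e' -> e <> e' -> L2dot e e' = 0].
have [F FP Ftot|S [[SL2 S1 S0] Smax]] := @Zorn_bigcup (R -> R[i]) P.
  split.
  - by move=> e [X /FP[+ _ _]]; apply.
  - by move=> e [X /FP[_ + _]]; apply.
  - move=> e e' [X FX Xe] [Y FY Ye']; have [XY|YX] := Ftot _ _ FX FY.
      by have [_ _ +] := FP _ FY; apply => //; exact: XY.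
    by have [_ _ +] := FP _ FX; apply => //; exact: YX.
exists S; split => // f Lf fS; apply: energy0_aeq => //.
apply: contrapT => /eqP E0.
pose c := ((Num.sqrt (energy mu f))^-1)%:C : R[i].
pose u := fun x => c * f x.
have Lu : L2 u by exact: L2Z.
have uu : L2dot u u = 1.
  rewrite L2dot_energy energyZ// sqn_rc exprVn sqr_sqrtr ?energy_ge0//.
  by rewrite mulVf.
have uS e : S e -> L2dot u e = 0.
  by move=> Se; rewrite L2dotZl ?fS ?mulr0//; exact: SL2.
have Su e : S e -> L2dot e u = 0.
  by move=> Se; rewrite L2dotC ?uS ?conjC0//; exact: SL2.
apply: (Smax (u |` S)).
  split; first by move=> e; right.
  by move=> /(_ u (or_introl erefl))/uS/eqP; rewrite uu oner_eq0.
split.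
- by move=> e [->//|/SL2].
- by move=> e [->//|/S1].
- move=> e e' [->|Se] [->|Se'] ne //; [exact: uS|exact: Su|exact: S0].
Qed.

End Sums.

(** * The compressed projection and its partial traces *)

Section Compression.
Variables (R : realType) (mu : {measure set (measurableTypeR R) -> \bar R}).
Variables (U : set R) (H : set (R -> R[i])) (K : R -> R -> R[i]).
Hypotheses (HRK : RK_subspace mu U H) (HK : reproducing_kernel mu U H K).
Implicit Types f g h : R -> R[i].
Local Notation L2 := (L2 mu).
Local Notation L2dot := (L2dot mu).
Local Notation energy := (energy mu).
Local Notation P := (integral_operator mu U K).

(* K x y is unconstrained for y outside U, where the integral does not look. *)
Lemma integral_operator_in x f : U x -> P f x = L2dot f (fun y => K y x).
Proof.
move=> Ux; have [HKx Kx] := HK Ux.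
have KC y : U y -> K x y = (K y x)^*.
  move=> Uy; have [HKy Ky] := HK Uy.
  by rewrite (Kx _ HKy) (Ky _ HKx) -L2dotC//; exact: (RK_L2 HRK).
have e y : (if y \in U then K x y * f y else 0) = f y * (K y x)^*.
  case: ifPn => [/set_mem Uy|/negP nUy]; first by rewrite KC// mulrC.
  have -> : K y x = 0.
    by have /= -> // := RK_out HRK (x := y) HKx; move=> Uy; exact/nUy/mem_set.
  by rewrite conjC0 mulr0.
apply: eq_complexP; rewrite /integral_operator /Defs.L2dot.
  rewrite !Re_cintegral Rintegral_mkcond; apply: eq_Rintegral => y _.
  by rewrite -e patchE; case: ifP.
rewrite !Im_cintegral Rintegral_mkcond; apply: eq_Rintegral => y _.
by rewrite -e patchE; case: ifP.
Qed.

Lemma integral_operator_out x f : ~ U x -> P f x = 0.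
Proof.
move=> nUx; have K0 y : U y -> K x y = 0.
  by move=> /HK[HKy _]; exact: (RK_out HRK HKy nUx).
have -> : P f x = cintegral mu U (fun=> 0).
  apply: eq_complexP; rewrite /integral_operator ?(Re_cintegral, Im_cintegral).
    by apply: eq_Rintegral => y /set_mem Uy; rewrite K0// mul0r.
  by apply: eq_Rintegral => y /set_mem Uy; rewrite K0// mul0r.
apply: eq_complexP; rewrite ?(Re_cintegral, Im_cintegral) /Rintegral.
  by rewrite integral0_eq.
by rewrite integral0_eq.
Qed.

(** For x in [U], the difference between [P f] and the projection [h] is $\langle f-h,K_x\rangle=0$;
    off [U] both vanish. Hence [P f] is the function [h] itself, not merely a representative of its
    class. *)
Lemma integral_operator_projection f : L2 f ->
  H (P f) /\ forall u, H u -> L2dot u f = L2dot u (P f).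
Proof.
move=> Lf; have [h Hh hf] := projection HRK Lf.
have -> : P f = h.
  apply/funext => x; have [Ux|nUx] := pselect (U x); last first.
    by rewrite integral_operator_out// (RK_out HRK Hh).
  have [HKx Kx] := HK Ux; have LKx := RK_L2 HRK HKx.
  rewrite integral_operator_in// (Kx _ Hh); apply/eqP; rewrite -subr_eq0.
  rewrite -L2dotBl//; last exact: (RK_L2 HRK).
  rewrite L2dotC ?hf ?conjC0//; exact: L2B Lf (RK_L2 HRK Hh).
split => // u Hu; have Lh := RK_L2 HRK Hh; have Lu := RK_L2 HRK Hu.
rewrite [LHS]L2dotC// [RHS]L2dotC//; congr (_^*).
apply/eqP; rewrite -subr_eq0 -L2dotBl// L2dotC ?hf ?conjC0//.
exact: L2B Lf Lh.
Qed.

Lemma integral_operator_L2 f : L2 f -> L2 (P f).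
Proof. by move=> /integral_operator_projection[/(RK_L2 HRK)]. Qed.

Lemma integral_operator_contract f : L2 f -> energy (P f) <= energy f.
Proof.
move=> Lf; have LP := integral_operator_L2 Lf.
have [HP /(_ _ HP) PP] := integral_operator_projection Lf.
have := energyB LP Lf; rewrite PP L2dot_energy Re_rc.
have := energy_ge0 mu (fun x => P f x - f x); lra.
Qed.

Lemma integral_operator_lin (a : R[i]) f g : L2 f -> L2 g ->
  P (fun x => a * f x + g x) = (fun x => a * P f x + P g x).
Proof.
move=> Lf Lg; apply/funext => x; have [Ux|nUx] := pselect (U x); last first.
  by rewrite !integral_operator_out// mulr0 addr0.
have [HKx _] := HK Ux.
by rewrite !integral_operator_in// L2dot_linl//; exact: (RK_L2 HRK).
Qed.

Variable (Om : set R).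
Hypothesis mOm : measurable (Om : set (measurableTypeR R)).
Local Notation chi := (mul_indic Om).

Lemma chi_lin (a : R[i]) f g :
  chi (fun x => a * f x + g x) = (fun x => a * chi f x + chi g x).
Proof. by apply/funext => x; rewrite /mul_indic; ring. Qed.

Lemma sqn_chi f x : sqn (chi f x) <= sqn (f x).
Proof.
rewrite /mul_indic sqnM sqn_rc indicE; case: (_ \in _).
  by rewrite expr1n mul1r.
by rewrite expr0n mul0r sqn_ge0.
Qed.

Lemma chi_L2 f : L2 f -> L2 (chi f).
Proof.
move=> Lf; apply: L2_le (sqn_chi f) (L2_int Lf).
apply: borelM (L2_borel Lf); split => /=; last exact: measurable_cst.
exact: measurable_indic.
Qed.

Lemma chi_dot f g : L2dot (chi f) g = L2dot f (chi g).
Proof.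
congr cintegral; apply/funext => x; rewrite /mul_indic.
by apply: eq_complexP; rewrite !cE; ring.
Qed.

Lemma chi_contract f : L2 f -> energy (chi f) <= energy f.
Proof.
move=> Lf; apply: le_Rintegral => //; first exact: L2_int (chi_L2 Lf).
  exact: L2_int.
by move=> x _; exact: sqn_chi.
Qed.

Definition compression f : R -> R[i] := chi (P (chi f)).

(** The indicator is symmetric and P is an orthogonal projection. This form shows self-adjointness
    and positivity at once. *)
Lemma compression_dot f g : L2 f -> L2 g ->
  L2dot (compression f) g = L2dot (P (chi f)) (P (chi g)).
Proof.
move=> Lf Lg; rewrite chi_dot.
have [HP _] := integral_operator_projection (chi_L2 Lf).
by have [_ ->] := integral_operator_projection (chi_L2 Lg).
Qed.

Lemma compression_L2 f : L2 f -> L2 (compression f).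
Proof. by move=> Lf; apply: chi_L2; apply: integral_operator_L2; exact: chi_L2. Qed.

Lemma compression_bounded : bounded_operator mu compression.
Proof.
split; first exact: compression_L2.
- move=> a f g Lf Lg; apply: aeW => x.
  by rewrite /compression chi_lin integral_operator_lin ?chi_lin//; exact: chi_L2.
- exists 1 => f Lf; rewrite mul1r !L2normE ler_wsqrtr//.
  apply: le_trans (chi_contract (integral_operator_L2 (chi_L2 Lf))) _.
  apply: le_trans (integral_operator_contract (chi_L2 Lf)) _.
  exact: chi_contract.
Qed.

Lemma compression_abs : absolute_value mu compression compression.
Proof.
split; first exact: compression_bounded.
  move=> f Lf; rewrite compression_dot// L2dot_energy ler0c.
  exact: energy_ge0.
exists compression; split; first exact: compression_bounded.
  move=> f g Lf Lg; rewrite [RHS]L2dotC//; last exact: compression_L2.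
  rewrite !compression_dot// -L2dotC//; apply: integral_operator_L2; exact: chi_L2.
by move=> f _; exact: aeW.
Qed.

(* With f_x = sum_i conj(e_i(x)) P(chi e_i), integrate over Om
   2 Re f_x(x) <= ||f_x||^2 + G(x): the left-hand side gives twice the partial
   trace, and the integral of ||f_x||^2 is again the partial trace. *)
Lemma partial_trace_le (G : R -> R) n (e : 'I_n -> R -> R[i]) :
  rint mu G -> (forall x, 0 <= G x) ->
  (forall x f, Om x -> H f -> sqn (f x) <= G x * energy f) ->
  (forall i, L2 (e i)) -> (forall i j, L2dot (e i) (e j) = (i == j)%:R) ->
  \sum_i energy (P (chi (e i))) <= \int[mu]_x G x.
Proof.
move=> rG G0 HG Le eij; pose h i := P (chi (e i)).
have Hh i : H (h i) by have [] := integral_operator_projection (chi_L2 (Le i)).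
have Lh i := RK_L2 HRK (Hh i).
pose F x := fun y => \sum_i (e i x)^* * h i y.
have HF x : H (F x) by exact: (RK_sum HRK).
(* [z] is the Gram matrix of the [h i], and [Phi x] expands $\|F_x\|^2$ by it. Upon integration,
   orthonormality of the [e i] leaves only the diagonal. *)
pose z (ij : 'I_n * 'I_n) := L2dot (h ij.1) (h ij.2).
pose Phi x := \sum_ij z ij * (e ij.2 x * (e ij.1 x)^*).
pose Psi x := \sum_i 1 * (chi (h i) x * (e i x)^*).
have cPhi : cint mu Phi by apply: cint_sum => ij; exact: cint_dot.
have cPsi : cint mu Psi by apply: cint_sum => i; apply: cint_dot => //; exact: chi_L2.
have PhiE x : energy (F x) = complex.Re (Phi x).
  rewrite -[LHS]Re_rc -L2dot_energy; congr complex.Re.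
  rewrite L2dot_suml//; last exact: (RK_L2 HRK).
  under eq_bigr do rewrite L2dot_sumr// big_distrr.
  rewrite pair_big; apply: eq_bigr => -[i j] _ /=.
  by rewrite conjCK /z /=; ring.
have PhiI : cintegral mu setT Phi = (\sum_i energy (h i))%:C.
  rewrite cintegral_sum; last by move=> ij; exact: cint_dot.
  under eq_bigr => ij _ do rewrite -/(L2dot _ _) eij.
  rewrite -(pair_bigA _ (fun i j => z (i, j) * (j == i)%:R))/= real_complex_sum.
  apply: eq_bigr => i _.
  by rewrite (sum_mul_delta (fun j => z (i, j))) /z L2dot_energy.
have PsiI : cintegral mu setT Psi = (\sum_i energy (h i))%:C.
  rewrite cintegral_sum; last first.
    by move=> i; apply: cint_dot => //; exact: chi_L2.
  rewrite real_complex_sum; apply: eq_bigr => i _; rewrite mul1r.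
  by transitivity (L2dot (compression (e i)) (e i));
    [|rewrite compression_dot// L2dot_energy].
(* On [Om], from $|F_x(x)|^2\le G(x)\|F_x\|^2$ and the inequality of arithmetic and geometric means;
   elsewhere [Psi] is 0. *)
have pt x : 2 * complex.Re (Psi x) <= complex.Re (Phi x) + G x.
  have -> : Psi x = (\1_Om x)%:C * F x x.
    by rewrite big_distrr; apply: eq_bigr => i _; rewrite /mul_indic /=; ring.
  rewrite -PhiE cE Re_rc Im_rc mul0r subr0 indicE.
  have E0 := energy_ge0 mu (F x); have Gx0 := G0 x.
  case: (boolP (x \in Om)) => [/set_mem Omx|_]; last by rewrite mul0r mulr0 addr_ge0.
  rewrite mul1r; have := HG x _ Omx (HF x); rewrite /sqn => le1.
  have : (2 * complex.Re (F x x)) ^+ 2 <= (energy (F x) + G x) ^+ 2.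
    have := sqr_ge0 (complex.Im (F x x)).
    have := sqr_ge0 (energy (F x) - G x).
    rewrite exprMn sqrrB sqrrD; lra.
  have EG : 0 <= energy (F x) + G x by exact: addr_ge0.
  apply: contraLR; rewrite -!ltNge => lt.
  by rewrite ltr_sqr ?nnegrE// (le_trans EG)// ltW.
have : \int[mu]_x (2 * complex.Re (Psi x)) <=
    \int[mu]_x (complex.Re (Phi x) + G x).
  apply: le_Rintegral => //; first exact: rintZ cPsi.1.
  exact: rintD cPhi.1 rG.
rewrite RintZ ?RintD//; [|exact: cPhi.1|exact: cPsi.1].
by rewrite -!(Re_cintegral mu setT) PhiI PsiI !Re_rc; lra.
Qed.

End Compression.

Theorem corollary3p7 (R : realType)
    (mu : {sigma_finite_measure set (measurableTypeR R) -> \bar R})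
    (U : set R) (H : set (R -> R[i])) (K : R -> R -> R[i])
    (mu_atomless : without_atoms mu)
    (U_open : open U) (mu_U : mu (~` U) = 0%E)
    (H_RK : RK_subspace mu U H)
    (H_sep : separates_zeros U H)
    (H_div : division_property U H)
    (K_H : reproducing_kernel mu U H K) :
  forall Om : set R, compact Om -> Om `<=` U ->
    trace_class mu
      (fun f => mul_indic Om (integral_operator mu U K (mul_indic Om f))).
Proof.
move=> Om cOm OmU.
have [G [rG G0 HG]] := eval_compact_bound H_RK mu_atomless H_sep H_div cOm OmU.
have mOm := compact_measurable cOm.
split; first exact: compression_bounded H_RK K_H _ mOm.
exists (compression mu U K Om); split; first exact: compression_abs H_RK K_H _ mOm.
have [S basisS] := ex_orthonormal_basis mu; exists S; split => //.
have [SL2 S1 S0 _] := basisS.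
apply: (@le_lt_trans _ _ (\int[mu]_x G x)%:E); last exact: ltry.
(* The sum over [S] is a supremum over finite subsets, and each of these is a finite orthonormal
   family. *)
apply: ge_ereal_sup => _ [A [finA AS] <-].
rewrite fsbig_finite// sumEFin lee_fin.
set s := finmap.enum_fset _.
have sS e : e \in s -> S e by rewrite in_fset_set// => /set_mem/AS.
rewrite (big_nth (fun=> 0)) big_mkord.
have nthS (i : 'I_(size s)) : S (nth (fun=> 0) s i) by exact/sS/mem_nth.
apply: le_trans (partial_trace_le H_RK K_H mOm (e := fun i => nth (fun=> 0) s i)
  rG G0 HG _ _).
- apply: ler_sum => i _.
  rewrite (compression_dot H_RK K_H mOm) ?L2dot_energy//; exact: SL2.
- by move=> i; exact: SL2.
- move=> i j; have [<-|ij] := eqVneq i j; first exact: S1.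
  apply: S0 => // /eqP; rewrite nth_uniq//; last exact: finmap.fset_uniq.
  exact/negP.
Qed.
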